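(* Let $1\le p\le n/2$ and let $\mathcal{Y}_1,\dots,\mathcal{Y}_N$ be points of the Grassmann manifold $Grass(p,n)$ of $p$-dimensional subspaces of $\mathbb{R}^n$, with weights $w_k>0$, represented by the orthonormal projectors $\Pi_1,\dots,\Pi_N$. Let $C_e=\frac1W\sum_{k=1}^N w_k\Pi_k$, $W=\sum_{k=1}^N w_k$. Then the induced arithmetic mean $IAM$ of these points contains all dominant $p$-eigenspaces of $C_e$. It reduces to a single point if the $p$-th largest and $(p+1)$-th largest eigenvalues of $C_e$ (counted with multiplicity) are different.
   Context: $\mathcal{Y}\in Grass(p,n)$ is represented by the orthonormal projector $\Pi_{\mathcal{Y}}=YY^T$ onto $\mathcal{Y}$, where $Y$ is any $n\times p$ matrix with orthonormal columns spanning $\mathcal{Y}$; this identifies $Grass(p,n)$ with the set of rank-$p$ orthonormal projectors in $\mathbb{R}^{n\times n}$, with Frobenius norm $\|B\|=\sqrt{\mathrm{trace}(B^TB)}$. The induced arithmetic mean is the set of global minimizers $$IAM=\mathop{\mathrm{argmin}}_{\mathcal{Y}\in Grass(p,n)}\sum_{k=1}^N w_k\|\Pi_k-\Pi_{\mathcal{Y}}\|^2,$$ equivalently $IAM=\mathop{\mathrm{argmax}}_{\mathcal{Y}\in Grass(p,n)}\mathrm{trace}(\Pi_{\mathcal{Y}}C_e)$. A dominant $p$-eigenspace of the symmetric matrix $C_e$ is a $p$-dimensional subspace spanned by orthonormal eigenvectors of $C_e$ corresponding to $p$ largest eigenvalues (counted with multiplicity). *)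

(* Defs.v *)
From HB Require Import structures.
From mathcomp Require Import all_boot all_order all_algebra.
From mathcomp Require Import polyrcf.
From mathcomp Require Import boolp classical_sets reals.

Set Implicit Arguments.
Unset Strict Implicit.
Unset Printing Implicit Defensive.

Import Order.TTheory GRing.Theory Num.Theory.

Local Open Scope classical_set_scope.
Local Open Scope ring_scope.

Definition Grass (R : realType) (p n : nat) : set {vspace 'cV[R]_n} :=
  [set U | \dim U = p].

Definition colspan (R : realType) (n p : nat) (Y : 'M[R]_(n, p)) :
    {vspace 'cV[R]_n} :=
  <<[seq col j Y | j <- enum 'I_p]>>%VS.

Definition orthonormal_basis (R : realType) (n p : nat)
    (U : {vspace 'cV[R]_n}) (Y : 'M[R]_(n, p)) : Prop :=
  Y^T *m Y = 1%:M /\ colspan Y = U.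

(* The default value 0 of [xget] is never used, and the value does not depend
   on the choice of Y: see [projectorP] and [projectorE]. *)
Definition projector (R : realType) (n : nat) (U : {vspace 'cV[R]_n}) :
    'M[R]_n :=
  xget 0 [set P | exists p : nat, exists2 Y : 'M[R]_(n, p),
                    orthonormal_basis U Y & P = Y *m Y^T].

(* [`|B|] is not used: on matrices it denotes the maximum norm. *)
Definition frobenius_norm (R : realType) (m n : nat) (B : 'M[R]_(m, n)) : R :=
  Num.sqrt (\tr (B^T *m B)).

Definition IAM (R : realType) (p n N : nat) (w : 'I_N -> R)
    (Y : 'I_N -> {vspace 'cV[R]_n}) : set {vspace 'cV[R]_n} :=
  let cost U :=
    \sum_(k < N) w k * frobenius_norm (projector (Y k) - projector U) ^+ 2 in
  [set U | Grass p U /\ forall V, Grass p V -> cost U <= cost V].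

Definition mean_projector (R : realType) (n N : nat) (w : 'I_N -> R)
    (Y : 'I_N -> {vspace 'cV[R]_n}) : 'M[R]_n :=
  (\sum_(k < N) w k)^-1 *: \sum_(k < N) w k *: projector (Y k).

(* The real eigenvalues of A in decreasing order, each repeated according to
   its multiplicity as a root of the characteristic polynomial. *)
Definition eigenvalues (R : realType) (n : nat) (A : 'M[R]_n) : seq R :=
  sort >=%R (flatten [seq nseq (mup a (char_poly A)) a
                     | a <- rootsR (char_poly A)]).

(* The k-th largest eigenvalue, counted from k = 1. *)
Definition kth_eigenvalue (R : realType) (n : nat) (A : 'M[R]_n) (k : nat) : R :=
  nth 0 (eigenvalues A) k.-1.

Definition dominant_eigenspace (R : realType) (p n : nat) (A : 'M[R]_n) :
    set {vspace 'cV[R]_n} :=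
  [set U | Grass p U /\
     exists2 V : 'M[R]_(n, p), orthonormal_basis U V
       & forall j : 'I_p, A *m col j V = kth_eigenvalue A j.+1 *: col j V].

Lemma mem_colspan (R : realType) (n p : nat) (Y : 'M[R]_(n, p)) (x : 'cV[R]_n) :
  reflect (exists c : 'cV[R]_p, x = Y *m c) (x \in colspan Y).
Proof.
have mulE (c : 'cV[R]_p) : Y *m c = \sum_j c j 0 *: col j Y.
  apply/matrixP=> i k; rewrite !mxE summxE; apply: eq_bigr => j _.
  by rewrite !mxE mulrC ord1.
apply: (iffP idP) => [|[c ->]]; last first.
  rewrite mulE memv_suml // => j _; apply/memvZ/memv_span.
  by apply: map_f; rewrite mem_enum.
rewrite /colspan span_def big_map big_enum /= => /memv_sumP [v hv ->].
have /fin_all_exists [c hc] j : exists a, v j = a *: col j Y.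
  by apply/vlineP/hv.
exists (\col_j c j); rewrite mulE.
by apply: eq_bigr => j _; rewrite mxE hc.
Qed.

Lemma proj_colspan (R : realType) (n p : nat) (U : {vspace 'cV[R]_n})
    (Y : 'M[R]_(n, p)) (x : 'cV[R]_n) :
  orthonormal_basis U Y -> x \in U -> Y *m Y^T *m x = x.
Proof.
by case=> hY <- /mem_colspan [c ->]; rewrite mulmxA -(mulmxA Y) hY mulmx1.
Qed.

Lemma orthonormal_basis_projector_uniq (R : realType) (n p q : nat)
    (U : {vspace 'cV[R]_n}) (Y : 'M[R]_(n, p)) (Z : 'M[R]_(n, q)) :
  orthonormal_basis U Y -> orthonormal_basis U Z -> Y *m Y^T = Z *m Z^T.
Proof.
have absorb p1 p2 (Y1 : 'M[R]_(n, p1)) (Y2 : 'M[R]_(n, p2)) :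
    orthonormal_basis U Y1 -> orthonormal_basis U Y2 ->
    Y1 *m Y1^T *m (Y2 *m Y2^T) = Y2 *m Y2^T.
  move=> h1 h2; rewrite mulmxA; congr (_ *m _).
  apply: trmx_inj; apply/row_matrixP => j; rewrite -!tr_col; congr _^T.
  rewrite colE -mulmxA -colE (proj_colspan h1) //; case: h2 => _ <-.
  by apply/mem_colspan; exists (delta_mx j 0); rewrite colE.
move=> hY hZ; rewrite -[LHS](absorb _ _ _ _ hZ hY).
apply: trmx_inj; rewrite !trmx_mul !trmxK; exact: absorb hY hZ.
Qed.

Lemma orthonormal_basis_exists (R : realType) (n : nat)
    (U : {vspace 'cV[R]_n}) :
  exists p : nat, exists Y : 'M[R]_(n, p), orthonormal_basis U Y.
Proof.
have <- : <<vbasis U>>%VS = U by apply/span_basis/vbasisP.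
elim: (tval (vbasis U)) => [|v X [p [Y [hY hX]]]].
  exists 0, 0; split; first by apply/matrixP => -[].
  by rewrite /colspan enum_ord0.
rewrite span_cons -hX.
pose u := v - Y *m (Y^T *m v).
have [u0|u0] := eqVneq u 0.
  exists p, Y; split=> //; apply/esym/addv_idPr.
  rewrite -memvE; apply/mem_colspan; exists (Y^T *m v).
  by apply/eqP; rewrite -subr_eq0 -/u u0.
have Yu : Y^T *m u = 0 by rewrite mulmxBr [Y^T *m (Y *m _)]mulmxA hY mul1mx subrr.
have uuE : (u^T *m u) 0 0 = \sum_i u i 0 ^+ 2.
  by rewrite mxE; apply: eq_bigr => i _; rewrite mxE expr2.
have uu_gt0 : 0 < (u^T *m u) 0 0.
  rewrite lt0r uuE sumr_ge0 ?andbT => [|i _]; last exact: sqr_ge0.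
  apply/eqP => uu0; case/eqP: u0; apply/colP => i; apply/eqP.
  rewrite [X in _ == X]mxE -sqrf_eq0; apply/eqP.
  by apply: (psumr_eq0P _ uu0) => // k _; exact: sqr_ge0.
pose s := (Num.sqrt ((u^T *m u) 0 0))^-1.
have s0 : s != 0 by rewrite invr_neq0 // gt_eqF // sqrtr_gt0.
have hs : s ^+ 2 * (u^T *m u) 0 0 = 1.
  by rewrite exprVn sqr_sqrtr ?ltW // mulVf // gt_eqF.
exists (p + 1)%N, (row_mx Y (s *: u)); split.
  rewrite tr_row_mx mul_col_row hY -scalemxAr Yu scaler0.
  have -> : (s *: u)^T *m Y = 0.
    by apply: trmx_inj; rewrite trmx_mul trmxK -scalemxAr Yu scaler0 trmx0.
  have -> : (s *: u)^T *m (s *: u) = 1%:M.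
    rewrite [(s *: u)^T]linearZ /= -scalemxAl -scalemxAr scalerA -expr2.
    by apply/matrixP => i j; rewrite !ord1 mxE hs mxE eqxx.
  by rewrite -scalar_mx_block.
apply/vspaceP => x; apply/mem_colspan/memv_addP.
  case=> c ->; rewrite -[c]vsubmxK mul_row_col; set c1 := usubmx c.
  set a := (dsubmx c) 0 0.
  have -> : s *: u *m dsubmx c = (s * a) *: u.
    by rewrite [dsubmx c]mx11_scalar mul_mx_scalar scalerA mulrC.
  exists ((s * a) *: v); first exact/memvZ/memv_line.
  exists (Y *m (c1 - (s * a) *: (Y^T *m v))).
    by apply/mem_colspan; eexists.
  by rewrite /u scalerBr mulmxBr -scalemxAr addrCA.
case=> _ /vlineP [a ->] [_ /mem_colspan [c ->] ->].
exists (col_mx (c + a *: (Y^T *m v)) (a / s)%:M).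
rewrite mul_row_col mul_mx_scalar scalerA divfK // /u scalerBr mulmxDr.
by rewrite -scalemxAr [a *: v - _]addrC addrA addrK addrC.
Qed.

Lemma projectorE (R : realType) (n p : nat) (U : {vspace 'cV[R]_n})
    (Y : 'M[R]_(n, p)) :
  orthonormal_basis U Y -> projector U = Y *m Y^T.
Proof.
move=> hY; rewrite /projector; case: xgetP => [_ _ [q [Z hZ ->]]|/(_ (Y *m Y^T))].
  exact: orthonormal_basis_projector_uniq hZ hY.
by case; exists p, Y.
Qed.

Lemma projectorP (R : realType) (n : nat) (U : {vspace 'cV[R]_n}) :
  exists p : nat, exists2 Y : 'M[R]_(n, p),
    orthonormal_basis U Y & projector U = Y *m Y^T.
Proof.
have [p [Y hY]] := orthonormal_basis_exists U.
by exists p, Y => //; exact: projectorE.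
Qed.

Lemma eigenvaluesE (R : realType) (n : nat) (A : 'M[R]_n) (s : seq R) :
  sorted >=%R s -> char_poly A = \prod_(a <- s) ('X - a%:P) ->
  eigenvalues A = s.
Proof.
move=> s_sorted hs; have ge_total : total (>=%R : rel R).
  by move=> x y; exact: le_total.
apply: (sorted_eq (leT := >=%R)) => //.
- by move=> y x z hxy hyz; exact: le_trans hyz hxy.
- by move=> x y /le_anti.
- exact: sort_sorted.
have pn0 : char_poly A != 0 by rewrite monic_neq0 // char_poly_monic.
have mupE a : mup a (char_poly A) = count_mem a s.
  rewrite hs; elim: (s) => [|b t IH].
    by rewrite big_nil mupNroot // root1.
  rewrite big_cons mupM ?polyXsubC_eq0 //; last first.
    by rewrite monic_neq0 // monic_prod_XsubC.
  by rewrite -['X - b%:P]expr1 mup_XsubCX IH /= eq_sym; case: eqP.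
rewrite perm_sort; apply/allP => x _ /=; apply/eqP.
rewrite -mupE count_flatten -map_comp sumnE big_map.
rewrite (eq_bigr (fun a => if a == x then mup x (char_poly A) else 0%N)).
  rewrite -big_mkcond /= big_const_seq iter_addn addn0.
  rewrite count_uniq_mem ?uniq_roots // -roots_on_rootsR // in_itv /=.
  have [_|/mupNroot ->] := boolP (root _ x); last by rewrite mul0n.
  by rewrite muln1.
by move=> a _ /=; rewrite count_nseq /=; case: eqP => [->|_]; rewrite ?mul1n.
Qed.

(* Main.v *)
(* Expanding the square, the cost of U is 2 W (p - tr (Pi_U C_e)), so the IAM
   maximizes tr (Pi_U C_e). In an orthonormal eigenbasis of C_e this trace is
   sum_i d_i q_i, where the q_i are the diagonal entries of Pi_U: they lie in
   [0, 1] and add up to p. Hence it is at most d_1 + ... + d_p, a value attained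
   by the dominant eigenspaces. If d_p > d_(p+1), equality forces q_i = 1 for
   i <= p and q_i = 0 for i > p, which determines Pi_U. *)
Require Import Defs.
From HB Require Import structures.
From mathcomp Require Import all_boot all_order all_algebra all_fingroup.
From mathcomp Require Import boolp classical_sets reals complex.

Set Implicit Arguments.
Unset Strict Implicit.
Unset Printing Implicit Defensive.

Import Order.TTheory GRing.Theory Num.Theory.

Local Open Scope classical_set_scope.
Local Open Scope ring_scope.

(** * Spectral theorem for real symmetric matrices *)

(** Over [R[i]] an eigenvalue [c] exists. The complexified matrix [B] is Hermitian, so [c] is real
    and descends to [R]. *)
Lemma real_sym_eigenvalue (R : rcfType) (n : nat) (A : 'M[R]_n) :
  (0 < n)%N -> A^T = A -> exists a, eigenvalue A a.
Proof.
move=> n_gt0 symA; pose B : 'M[R[i]]_n := map_mx (real_complex R) A.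
have [c hc] := spectral.eigenvalue_closed B n_gt0.
suff /complex_realP [a ca] : c \is Num.real.
  by exists a; rewrite -(eigenvalue_map (real_complex R)); rewrite ca in hc.
have Bc i j : (B i j)^* = B j i.
  apply/esym; rewrite !mxE -{1}symA mxE; apply/esym/CrealP/complex_realP.
  by exists (A i j).
have /eigenvalueP [v vB v0] := hc.
pose s := \sum_i v 0 i * (v 0 i)^*.
have s0 : s != 0.
  apply: contraNneq v0 => /psumr_eq0P s0; apply/eqP/rowP => i; apply/eqP.
  rewrite mxE -mul_conjC_eq0 s0 // => j _; exact: mul_conjC_ge0.
have vBE j : \sum_i v 0 i * B i j = c * v 0 j.
  by have /matrixP/(_ 0 j) := vB; rewrite !mxE.
(* With [s] the squared norm of [v], both [c^* * s] and [c * s] evaluate the form [v B v^*], so [c]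
   equals its conjugate. *)
apply/CrealP/(mulIf s0).
transitivity (\sum_j v 0 j * (c * v 0 j)^*).
  by rewrite mulr_sumr; apply: eq_bigr => j _; rewrite rmorphM mulrCA.
transitivity (\sum_j (c * v 0 j) * (v 0 j)^*); last first.
  by rewrite mulr_sumr; apply: eq_bigr => j _; rewrite mulrA.
transitivity (\sum_j \sum_i v 0 j * ((v 0 i)^* * B j i)).
  apply: eq_bigr => j _; rewrite -vBE rmorph_sum mulr_sumr.
  by apply: eq_bigr => i _; rewrite rmorphM /= Bc.
rewrite exchange_big; apply: eq_bigr => i _; rewrite -vBE mulr_suml.
by apply: eq_bigr => j _; rewrite mulrA mulrAC.
Qed.

Lemma tr_mul_self_ge0 (R : realDomainType) (m n : nat) (B : 'M[R]_(m, n)) :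
  0 <= \tr (B^T *m B).
Proof.
by apply: sumr_ge0 => i _; rewrite mxE; apply: sumr_ge0 => j _;
   rewrite mxE -expr2 sqr_ge0.
Qed.

Lemma tr_mul_self_eq0 (R : realDomainType) (m n : nat) (B : 'M[R]_(m, n)) :
  \tr (B^T *m B) = 0 -> B = 0.
Proof.
have sE j : (B^T *m B) j j = \sum_i B i j ^+ 2.
  by rewrite mxE; apply: eq_bigr => i _; rewrite mxE expr2.
have s0 j : 0 <= (B^T *m B) j j by rewrite sE sumr_ge0 // => i _; exact: sqr_ge0.
move=> /(psumr_eq0P (fun j _ => s0 j)) B0; apply/matrixP => i j.
rewrite mxE; apply/eqP; rewrite -sqrf_eq0; apply/eqP.
move: (B0 j isT); rewrite sE => /psumr_eq0P -> // k _; exact: sqr_ge0.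
Qed.

(** [eigenvalueP] provides a row eigenvector; by symmetry its transpose is a column eigenvector,
    which is then divided by its norm. *)
Lemma real_sym_unit_eigenvector (R : rcfType) (n : nat) (A : 'M[R]_n) :
  (0 < n)%N -> A^T = A ->
  exists a, exists2 v : 'cV[R]_n, v^T *m v = 1%:M & A *m v = a *: v.
Proof.
move=> n_gt0 symA.
have [a /eigenvalueP [v vA v0]] := real_sym_eigenvalue n_gt0 symA.
pose t := \tr (v^T^T *m v^T).
have t0 : 0 < t.
  rewrite lt0r tr_mul_self_ge0 andbT; apply: contraNneq v0 => /tr_mul_self_eq0.
  by move=> h; rewrite -[v]trmxK h trmx0.
exists a, ((Num.sqrt t)^-1 *: v^T).
  rewrite [(_ *: _)^T]linearZ /= -scalemxAl -scalemxAr scalerA -expr2 exprVn.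
  rewrite sqr_sqrtr ?ltW // [_ *m _]mx11_scalar -trace_mx11 -/t.
  by rewrite scale_scalar_mx mulVf // gt_eqF.
rewrite -scalemxAr scalerA mulrC -scalerA; congr (_ *: _).
by rewrite -[X in X *m _]symA -trmx_mul vA linearZ.
Qed.

(** Applied to [Y^T], this gives an orthonormal basis of the orthogonal complement of the columns of
    [Y]. *)
Lemma kernel_orthonormal_basis (R : realType) (m n : nat) (Y : 'M[R]_(m, n)) :
  exists q, exists Z : 'M[R]_(n, q),
    [/\ Z^T *m Z = 1%:M, Y *m Z = 0 &
        forall x : 'cV_n, Y *m x = 0 -> Z *m Z^T *m x = x].
Proof.
pose K := lker (linfun (mulmx Y : 'cV[R]_n -> 'cV[R]_m)).
have [q [Z hZ]] := orthonormal_basis_exists K.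
exists q, Z; split; first by case: hZ.
  apply: trmx_inj; apply/row_matrixP => j; rewrite -!tr_col; congr _^T.
  rewrite colE -mulmxA -colE.
  have : col j Z \in K.
    by case: hZ => _ <-; apply/mem_colspan; exists (delta_mx j 0); rewrite colE.
  rewrite memv_ker lfunE /= => /eqP ->.
  by apply/colP => i; rewrite !mxE.
move=> x Yx; apply: proj_colspan hZ _.
by rewrite memv_ker lfunE /= Yx.
Qed.

(** Deflation, by induction on [m]: compress [A] to the orthogonal complement of the eigenvectors
    already found, take a unit eigenvector [v] of the compression, and append [Z *m v]. *)
Lemma orthonormal_eigenvectors (R : realType) (n m : nat) (A : 'M[R]_n) :
  A^T = A -> (m <= n)%N ->
  exists d : 'rV[R]_m, exists2 Y : 'M[R]_(n, m),
    Y^T *m Y = 1%:M & A *m Y = Y *m diag_mx d.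
Proof.
move=> symA; elim: m => [|m IH] mn.
  by exists 0, 0; apply/matrixP; [case|move=> ? []].
have [d [Y YY AY]] := IH (ltnW mn).
have [q [Z [ZZ YZ hZ]]] := kernel_orthonormal_basis Y^T.
(* By symmetry [A] preserves the complement, so eigenvectors of the compression lift to eigenvectors
   of [A]. *)
have AZ : Z *m (Z^T *m A *m Z) = A *m Z.
  have YAZ : Y^T *m (A *m Z) = 0.
    by rewrite mulmxA -[A in LHS]symA -trmx_mul AY trmx_mul -mulmxA YZ mulmx0.
  apply: trmx_inj; apply/row_matrixP => j; rewrite -!tr_col; congr _^T.
  rewrite !colE -!mulmxA mulmxA hZ //.
  by move: YAZ; rewrite !mulmxA => ->; rewrite mul0mx.
(* Fewer than [n] columns cannot span the whole space, so the complement is nonzero. *)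
have q_gt0 : (0 < q)%N.
  case: q Z ZZ YZ hZ AZ => // Z _ _ hZ _.
  have : kermx Y != 0.
    rewrite -mxrank_eq0 mxrank_ker subn_eq0 -ltnNge.
    exact: leq_ltn_trans (rank_leq_col _) mn.
  case/rowV0Pn => u /sub_kermxP uY /negP []; apply/eqP.
  rewrite -[u]trmxK -(hZ u^T); last by rewrite -trmx_mul uY trmx0.
  by rewrite [Z]thinmx0 !mul0mx trmx0.
have [||a [v vv Bv]] := @real_sym_unit_eigenvector R q (Z^T *m A *m Z) => //.
  by rewrite !trmx_mul trmxK symA mulmxA.
rewrite -[m.+1]addn1.
exists (row_mx d a%:M), (row_mx Y (Z *m v)).
  have YZv : Y^T *m (Z *m v) = 0 by rewrite mulmxA YZ mul0mx.
  rewrite tr_row_mx mul_col_row YY YZv.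
  have -> : (Z *m v)^T *m Y = 0.
    by apply: trmx_inj; rewrite trmx_mul trmxK YZv trmx0.
  by rewrite trmx_mul -mulmxA (mulmxA Z^T) ZZ mul1mx vv -scalar_mx_block.
rewrite diag_mx_row mul_mx_row AY mul_row_block !mulmx0 addr0 add0r.
congr row_mx; rewrite mulmxA -AZ -mulmxA Bv -scalemxAr.
have -> : diag_mx a%:M = a%:M :> 'M_1.
  by apply/matrixP => i j; rewrite !ord1 !mxE.
by rewrite mul_mx_scalar.
Qed.

Lemma real_sym_spectral (R : realType) (n : nat) (A : 'M[R]_n) :
  A^T = A ->
  exists (d : 'rV[R]_n) (Q : 'M[R]_n),
    [/\ Q^T *m Q = 1%:M, A = Q *m diag_mx d *m Q^T
      & sorted >=%R [seq d 0 i | i <- enum 'I_n]].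
Proof.
move=> symA; have [d [Q QQ AQ]] := orthonormal_eigenvectors symA (leqnn n).
pose t := [tuple d 0 i | i < n].
(* The permutation [s] that sorts the eigenvalues is also applied to the columns of [Q]. *)
have [s hs] : exists s : 'S_n, sort >=%R t = [tuple tnth t (s i) | i < n].
  by apply/tuple_permP; rewrite perm_sort.
have Q1 : (col_perm s Q)^T *m col_perm s Q = 1%:M.
  rewrite col_permE trmx_mul -mulmxA (mulmxA Q^T) QQ mul1mx tr_perm_mx.
  by rewrite invgK -perm_mxM mulgV perm_mx1.
exists (col_perm s d), (col_perm s Q); split=> //.
  have <- : A *m col_perm s Q = col_perm s Q *m diag_mx (col_perm s d).
    apply/matrixP => i j; rewrite mul_mx_diag.
    have /matrixP/(_ i (s j)) := AQ.
    by rewrite mul_mx_diag !mxE => <-; apply: eq_bigr => k _; rewrite mxE.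
  by rewrite -mulmxA (mulmx1C Q1) mulmx1.
have -> : [seq col_perm s d 0 i | i <- enum 'I_n] = sort >=%R t.
  by rewrite hs; apply: eq_map => i; rewrite tnth_mktuple mxE.
by apply: sort_sorted => x y; exact: le_total.
Qed.

(** * Ordered eigenvalues and weighted sums *)

(** [Q] stays orthogonal over the polynomial ring, so conjugation by it leaves the characteristic
    polynomial unchanged, and that of a diagonal matrix is split. *)
Lemma eigenvalues_spectral (R : realType) (n : nat) (d : 'rV[R]_n) (Q : 'M[R]_n) :
  Q^T *m Q = 1%:M -> sorted >=%R [seq d 0 i | i <- enum 'I_n] ->
  eigenvalues (Q *m diag_mx d *m Q^T) = [seq d 0 i | i <- enum 'I_n].
Proof.
move=> QQ d_sorted; apply: eigenvaluesE => //.
rewrite big_map big_enum /=.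
pose P := map_mx polyC Q.
have PP : P *m P^T = 1%:M.
  by rewrite map_trmx -map_mxM (mulmx1C QQ) map_mx1.
transitivity (char_poly (diag_mx d)).
  rewrite /char_poly /char_poly_mx.
  have -> : 'X%:M - map_mx polyC (Q *m diag_mx d *m Q^T)
          = P *m ('X%:M - map_mx polyC (diag_mx d)) *m P^T.
    rewrite mulmxBr mulmxBl mul_mx_scalar -scalemxAl PP scalemx1.
    by rewrite !map_mxM /P map_trmx.
  by rewrite !det_mulmx mulrAC -det_mulmx PP det1 mul1r.
rewrite char_poly_trig ?diag_mx_is_trig //.
by apply: eq_bigr => i _; rewrite mxE eqxx.
Qed.

Lemma kth_eigenvalue_spectral (R : realType) (n : nat) (d : 'rV[R]_n)
    (Q : 'M[R]_n) (i : 'I_n) :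
  Q^T *m Q = 1%:M -> sorted >=%R [seq d 0 i | i <- enum 'I_n] ->
  kth_eigenvalue (Q *m diag_mx d *m Q^T) i.+1 = d 0 i.
Proof.
move=> QQ d_sorted; rewrite /kth_eigenvalue eigenvalues_spectral //=.
by rewrite (nth_map i) ?size_enum_ord // nth_ord_enum.
Qed.

(* The bound and its equality case come from the identity
   sum_(i < p) d_i - sum_i d_i q_i = sum_i (d_i - c) ([i < p] - q_i),
   valid for every c since q has total mass p; its terms are nonnegative as
   soon as c separates d_0, ..., d_(p-1) from the other d_i. *)
Lemma sum_weighted_top (R : realDomainType) (p n : nat) (d q : 'I_n -> R) (c : R) :
  (forall i, 0 <= q i <= 1) -> (p <= n)%N -> \sum_i q i = p%:R ->
  (forall i : 'I_n, (i < p)%N -> c <= d i) ->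
  (forall i : 'I_n, (p <= i)%N -> d i <= c) ->
  \sum_i d i * q i <= \sum_i d i * (i < p)%N%:R
    ?= iff [forall i, (d i == c) || (q i == (i < p)%N%:R)].
Proof.
move=> q01 pn sq hc1 hc2.
have sb : \sum_(i < n) (i < p)%N%:R = p%:R :> R.
  rewrite -natr_sum; congr _%:R.
  by rewrite -big_mkcond /= -(big_ord_widen _ (fun=> 1%N)) // sum1_card card_ord.
pose f i := (d i - c) * ((i < p)%N%:R - q i).
have fE : \sum_i f i = \sum_i d i * (i < p)%N%:R - \sum_i d i * q i.
  rewrite -sumrB; apply/eqP; rewrite -subr_eq0 -sumrB; apply/eqP.
  transitivity (- c * (\sum_(i < n) (i < p)%N%:R - \sum_i q i)).
    rewrite -sumrB mulr_sumr; apply: eq_bigr => i _.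
    by rewrite /f -mulrBr -mulrBl addrAC subrr add0r.
  by rewrite sb sq subrr mulr0.
have f0 i : 0 <= f i.
  have /andP [q0 q1] := q01 i; rewrite /f; case: ltnP => ip.
    by rewrite mulr_ge0 ?subr_ge0 ?hc1.
  by rewrite mulr_le0 ?sub0r ?oppr_le0 ?subr_le0 ?hc2.
split; first by rewrite -subr_ge0 -fE sumr_ge0.
rewrite eq_sym -subr_eq0 -fE psumr_eq0 //; apply/allP/forallP => h i.
  by have := h i (mem_index_enum _); rewrite mulf_eq0 !subr_eq0 [q i == _]eq_sym.
by move=> _; rewrite mulf_eq0 !subr_eq0 [_ == q i]eq_sym; exact: h.
Qed.

(** * Subspaces and their orthonormal projectors *)

Lemma dim_orthonormal_basis (R : realType) (n p : nat)
    (U : {vspace 'cV[R]_n}) (Y : 'M[R]_(n, p)) :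
  orthonormal_basis U Y -> \dim U = p.
Proof.
case=> YY <-; pose X := [tuple col j Y | j < p].
have -> : colspan Y = <<X>>%VS by [].
suff /eqP -> : free X by rewrite size_tuple.
apply/freeP => k k0 i.
have : Y *m (\col_j k j) = 0.
  rewrite -[RHS]k0; apply/matrixP => a b.
  rewrite !mxE summxE; apply: eq_bigr => j _.
  by rewrite (nth_map j) ?size_enum_ord // nth_ord_enum !mxE mulrC.
move/(congr1 (mulmx Y^T)); rewrite mulmxA YY mul1mx mulmx0 => /colP/(_ i).
by rewrite !mxE.
Qed.

(** [projectorP] leaves the number of columns open; the dimension of [U] fixes it to [p]. *)
Lemma Grass_projector (R : realType) (p n : nat) (U : {vspace 'cV[R]_n}) :
  Grass p U ->
  exists2 Y : 'M[R]_(n, p), orthonormal_basis U Y & projector U = Y *m Y^T.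
Proof.
have [q [Y hY ->]] := projectorP U => Up.
have qp : q = p by rewrite -Up (dim_orthonormal_basis hY).
by case: p / qp Up => _; exists Y.
Qed.

(** The projector of [U] fixes [U] pointwise, while the projector of [V] has its range in [V]. *)
Lemma projector_inj (R : realType) (n : nat) :
  injective (@projector R n).
Proof.
have sub (U V : {vspace 'cV[R]_n}) : projector U = projector V -> (U <= V)%VS.
  have [p [Y hY ->]] := projectorP U; have [q [Z hZ ->]] := projectorP V.
  move=> YZ; apply/subvP => x xU; rewrite -(proj_colspan hY xU) YZ -mulmxA.
  by case: hZ => _ <-; apply/mem_colspan; eexists.
move=> U V UV; apply/eqP; rewrite eqEsubv; apply/andP; split; exact: sub.
Qed.

Lemma projector_sym (R : realType) (n : nat) (U : {vspace 'cV[R]_n}) :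
  (projector U)^T = projector U.
Proof. by have [p [Y _ ->]] := projectorP U; rewrite trmx_mul trmxK. Qed.

Lemma projector_idem (R : realType) (n : nat) (U : {vspace 'cV[R]_n}) :
  projector U *m projector U = projector U.
Proof.
have [p [Y [YY _] ->]] := projectorP U.
by rewrite mulmxA -(mulmxA Y) YY mulmx1.
Qed.

Lemma tr_projector (R : realType) (p n : nat) (U : {vspace 'cV[R]_n}) :
  Grass p U -> \tr (projector U) = p%:R.
Proof.
case/Grass_projector => Y [YY _] ->.
by rewrite mxtrace_mulC YY mxtrace1.
Qed.

Lemma mean_projector_sym (R : realType) (n N : nat) (w : 'I_N -> R)
    (Y : 'I_N -> {vspace 'cV[R]_n}) :
  (mean_projector w Y)^T = mean_projector w Y.
Proof.
rewrite /mean_projector linearZ linear_sum; congr (_ *: _).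
by apply: eq_bigr => k _; rewrite linearZ /= projector_sym.
Qed.

(** * The induced arithmetic mean as a trace maximization problem *)

Lemma IAM_argmax (R : realType) (p n N : nat) (w : 'I_N -> R)
    (Y : 'I_N -> {vspace 'cV[R]_n}) (U : {vspace 'cV[R]_n}) :
  (0 < N)%N -> (forall k, 0 < w k) -> (forall k, Grass p (Y k)) ->
  IAM p w Y U <-> Grass p U /\ forall V, Grass p V ->
    \tr (projector V *m mean_projector w Y)
      <= \tr (projector U *m mean_projector w Y).
Proof.
move=> N_gt0 w_gt0 hY.
pose W := \sum_(k < N) w k.
have W_gt0 : 0 < W.
  rewrite /W (bigD1 (Ordinal N_gt0)) //= ltr_pwDl // sumr_ge0 // => k _.
  exact: ltW.
have costE V : Grass p V ->
    \sum_(k < N) w k * frobenius_norm (projector (Y k) - projector V) ^+ 2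
    = 2 * W * (p%:R - \tr (projector V *m mean_projector w Y)).
  move=> hV; pose C := \sum_k w k *: projector (Y k).
  (* The factor [W] cancels the normalization of the mean, so the identity can be checked term by
     term in [k]. *)
  have -> : 2 * W * (p%:R - \tr (projector V *m mean_projector w Y))
      = 2 * (W * p%:R - \tr (projector V *m C)).
    rewrite -mulrA mulrBr -scalemxAr linearZ /= mulrA mulfV ?mul1r //.
    by rewrite gt_eqF.
  rewrite /W mulr_suml mulmx_sumr [\tr _]raddf_sum /= -sumrB mulr_sumr.
  apply: eq_bigr => k _; rewrite -scalemxAr linearZ /= -mulrBr [RHS]mulrCA.
  congr (_ * _); rewrite /frobenius_norm sqr_sqrtr ?tr_mul_self_ge0 //.
  rewrite [(_ - _)^T]linearB /= !projector_sym mulmxBl !mulmxBr.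
  rewrite !projector_idem !raddfB /=.
  rewrite !(@tr_projector _ p) // (mxtrace_mulC (projector (Y k))).
  by rewrite opprK [- _ + _]addrC mulr_natl mulr2n.
by split=> -[hU U_opt]; split=> // V hV; have := U_opt V hV;
  rewrite !costE // ler_pM2l ?mulr_gt0 // lerD2l lerN2.
Qed.

(** In the eigenbasis the projector becomes a symmetric idempotent [q], so [q i i] is the sum of the
    squares of row [i] and lies in [[0, 1]]. The threshold [c] is left free: the bound and the
    uniqueness argument choose it differently. *)
Lemma tr_projector_top (R : realType) (p n : nat) (d : 'rV[R]_n) (Q : 'M[R]_n)
    (U : {vspace 'cV[R]_n}) (c : R) :
  Q^T *m Q = 1%:M -> (p <= n)%N -> Grass p U ->
  (forall i : 'I_n, (i < p)%N -> c <= d 0 i) ->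
  (forall i : 'I_n, (p <= i)%N -> d 0 i <= c) ->
  \tr (projector U *m (Q *m diag_mx d *m Q^T))
    <= \sum_(i < n) d 0 i * (i < p)%N%:R
    ?= iff [forall i, (d 0 i == c)
              || ((Q^T *m projector U *m Q) i i == (i < p)%N%:R)].
Proof.
move=> QQ pn hU hc1 hc2; set P := projector U; pose q := Q^T *m P *m Q.
have -> : \tr (P *m (Q *m diag_mx d *m Q^T)) = \sum_i d 0 i * q i i.
  rewrite !mulmxA mxtrace_mulC !mulmxA mul_mx_diag.
  by apply: eq_bigr => i _; rewrite mxE mulrC.
have QQ' := mulmx1C QQ.
have qq : q *m q = q.
  rewrite /q !mulmxA -(mulmxA (Q^T *m P)) QQ' mulmx1.
  by rewrite -(mulmxA Q^T) projector_idem.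
have q_sym : q^T = q by rewrite !trmx_mul trmxK projector_sym mulmxA.
have qiE i : q i i = \sum_j q i j ^+ 2.
  rewrite -{1}qq mxE; apply: eq_bigr => j _.
  rewrite expr2; congr (_ * _).
  by move/matrixP: q_sym => /(_ i j) <-; rewrite [RHS]mxE.
apply: sum_weighted_top => [i|//||//|//].
  have qii0 : 0 <= q i i by rewrite qiE sumr_ge0 // => j _; exact: sqr_ge0.
  rewrite qii0 /=; have : q i i ^+ 2 <= q i i.
    rewrite [leRHS]qiE (bigD1 i) //= lerDl sumr_ge0 // => j _; exact: sqr_ge0.
  rewrite expr2; have [->//|qii_gt0] := eqVneq (q i i) 0.
  by rewrite -[leRHS]mulr1 ler_pM2l // lt0r qii_gt0.
by rewrite -[LHS]/(\tr q) mxtrace_mulC mulmxA QQ' mul1mx (tr_projector hU).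
Qed.

(* Expand the squared norm of P v - b v, using P^T P = P. *)
Lemma projector_diag01 (R : realType) (n : nat) (U : {vspace 'cV[R]_n})
    (v : 'cV[R]_n) (b : bool) :
  v^T *m v = 1%:M -> (v^T *m projector U *m v) 0 0 = b%:R ->
  projector U *m v = b%:R *: v.
Proof.
move=> vv; set P := projector U => hb; apply/eqP; rewrite -subr_eq0; apply/eqP.
apply: tr_mul_self_eq0.
have PP : v^T *m P *m (P *m v) = b%:R%:M.
  by rewrite mulmxA -(mulmxA v^T) projector_idem [LHS]mx11_scalar hb.
rewrite [(_ - _)^T]linearB /= [(_ *: _)^T]linearZ /= trmx_mul projector_sym.
rewrite mulmxBl !mulmxBr PP -scalemxAl -!scalemxAr -scalemxAl vv.
rewrite mulmxA [v^T *m P *m v]mx11_scalar hb.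
(* All terms cancel because a boolean satisfies [b * b = b]. *)
by rewrite !scale_scalar_mx mulr1 -natrM mulnb andbb !subrr mxtrace0.
Qed.

Theorem proposition2 (R : realType) (p n N : nat)
    (w : 'I_N -> R) (Y : 'I_N -> {vspace 'cV[R]_n})
    (hp : (1 <= p)%N) (hpn : (2 * p <= n)%N) (hN : (0 < N)%N)
    (hw : forall k, 0 < w k) (hY : forall k, Grass p (Y k)) :
  dominant_eigenspace p (mean_projector w Y) `<=` IAM p w Y /\
  (kth_eigenvalue (mean_projector w Y) p
     != kth_eigenvalue (mean_projector w Y) p.+1 ->
   exists U : {vspace 'cV[R]_n}, IAM p w Y = [set U]).
Proof.
have IAM_P := IAM_argmax _ hN hw hY.
have [d [Q [QQ AE d_sorted]]] :=
  real_sym_spectral (mean_projector_sym w Y).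
move: (mean_projector w Y) AE IAM_P => A -> IAM_P {hN hw hY}.
(* Strictness makes the [(p+1)]-th eigenvalue, at index [p] from zero, a genuine entry and not the
   default of [nth]. *)
have pn : (p < n)%N.
  by rewrite (leq_trans _ hpn) // mul2n -addnn -{1}[p]addn0 ltn_add2l.
have d_anti (i j : 'I_n) : (i <= j)%N -> d 0 j <= d 0 i.
  have ge_trans : transitive (>=%R : rel R).
    by move=> y x z hxy hyz; exact: le_trans hyz hxy.
  have ge_refl : reflexive (>=%R : rel R) by move=> x; exact: lexx.
  have mem_s (k : 'I_n) :
      (k : nat) \in [pred m | (m < size [seq d 0%R i | i <- enum 'I_n])%N].
    by rewrite inE size_map size_enum_ord ltn_ord.
  move=> ij.
  have := sorted_leq_nth ge_trans ge_refl 0 d_sorted _ _ (mem_s i) (mem_s j) ij.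
  by rewrite 2?(nth_map i) ?size_enum_ord // !nth_ord_enum.
have dE := kth_eigenvalue_spectral _ QQ d_sorted.
pose top := \sum_(i < n) d 0 i * (i < p)%N%:R.
have bound V : Grass p V -> \tr (projector V *m (Q *m diag_mx d *m Q^T)) <= top.
  move=> hV; apply: (tr_projector_top (c := d 0 (Ordinal pn))) => //.
  - exact: ltnW.
  - by move=> i ip; apply: d_anti; exact: ltnW.
  - by move=> i ip; exact: d_anti.
have topE U : dominant_eigenspace p (Q *m diag_mx d *m Q^T) U ->
    \tr (projector U *m (Q *m diag_mx d *m Q^T)) = top.
  case=> _ [Z hZ eigZ]; rewrite (projectorE hZ) mxtrace_mulC mulmxA.
  rewrite mxtrace_mulC; set B := _ *m Q^T in eigZ *.
  (* The trace is now that of [Z^T *m (B *m Z)]; multiplying [eigZ j] by [Z^T] reads off its [j]-th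
     diagonal entry. *)
  transitivity (\sum_(j < p) d 0 (widen_ord (ltnW pn) j)).
    apply: eq_bigr => j _; have [ZZ _] := hZ.
    have := congr1 (mulmx Z^T) (eigZ j).
    rewrite -[j.+1]/((widen_ord (ltnW pn) j).+1) dE -scalemxAr colE.
    rewrite !mulmxA ZZ mul1mx => /colP/(_ j).
    by rewrite -colE !mxE !eqxx mulr1.
  rewrite /top (bigID (fun i : 'I_n => (i < p)%N)) /= [X in _ + X]big1 ?addr0.
    rewrite (big_ord_narrow (ltnW pn)); apply: eq_bigr => i _.
    by rewrite /= ltn_ord mulr1.
  by move=> i /negbTE ->; rewrite mulr0.
have dom_IAM : dominant_eigenspace p (Q *m diag_mx d *m Q^T) `<=` IAM p w Y.
  move=> U hU; apply/IAM_P; split; first by case: hU.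
  by move=> V hV; rewrite (topE U hU) bound.
split=> // gap.
have [U0 hU0] : exists U0, dominant_eigenspace p (Q *m diag_mx d *m Q^T) U0.
  (* [Z] consists of the first [p] columns of [Q]. *)
  pose Z : 'M_(n, p) := Q *m pid_mx p.
  have hZ : orthonormal_basis (colspan Z) Z.
    split=> //; rewrite trmx_mul tr_pid_mx -mulmxA (mulmxA Q^T) QQ mul1mx.
    by rewrite pid_mx_id ?pid_mx_1 // ltnW.
  exists (colspan Z); split; first exact: dim_orthonormal_basis hZ.
  exists Z => // j; pose i := widen_ord (ltnW pn) j.
  rewrite -[j.+1]/(i.+1) dE colE /Z !mulmxA -(mulmxA _ Q^T) QQ mulmx1.
  rewrite -!mulmxA scalemxAr; congr (_ *m _); rewrite -colE mul_diag_mx.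
  apply/colP => k; rewrite !mxE; case: eqP => [kj|_]; last by rewrite !mulr0.
  by have -> : k = i by exact: val_inj.
exists U0.
(* Counted from zero, [p.-1] is the position of the [p]-th largest eigenvalue. *)
have p'n : (p.-1 < n)%N by rewrite (leq_ltn_trans (leq_pred _) pn).
have gap_lt : d 0 (Ordinal pn) < d 0 (Ordinal p'n).
  rewrite lt_neqAle d_anti ?leq_pred // andbT eq_sym -!dE /=.
  by rewrite prednK.
(* Equality in the bound for c strictly inside the gap pins down the projector. *)
pose c := (d 0 (Ordinal pn) + d 0 (Ordinal p'n)) / 2.
have [c1 c2] := midf_lt gap_lt.
have proj_max U : Grass p U ->
    \tr (projector U *m (Q *m diag_mx d *m Q^T)) = top ->
    projector U = Q *m pid_mx p *m Q^T.
  move=> hU hmax.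
  have hc1 (i : 'I_n) : (i < p)%N -> c < d 0 i.
    by move=> ip; rewrite (lt_le_trans c2) // d_anti //= -ltnS prednK.
  have hc2 (i : 'I_n) : (p <= i)%N -> d 0 i < c.
    by move=> ip; rewrite (le_lt_trans _ c1) // d_anti.
  have /leifP := tr_projector_top QQ (ltnW pn) hU
    (fun i ip => ltW (hc1 i ip)) (fun i ip => ltW (hc2 i ip)).
  rewrite -/top hmax ltxx; case: forallP => // hq _.
  (* No [d 0 i] equals [c], so equality makes every diagonal entry 0 or 1; by [projector_diag01]
     each column of [Q] is then fixed or killed. *)
  have PQ : projector U *m Q = Q *m pid_mx p.
    apply: trmx_inj; apply/row_matrixP => i; rewrite -!tr_col; congr _^T.
    rewrite colE -mulmxA -colE (@projector_diag01 _ _ _ _ (i < p)%N).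
    - apply/colP => k; rewrite !mxE (bigD1 i) //= big1 ?addr0.
        by rewrite !mxE eqxx mulrC.
      by move=> j ji; rewrite mxE (inj_eq val_inj) (negbTE ji) mulr0.
    - rewrite tr_col colE rowE -mulmxA (mulmxA Q^T) QQ mul1mx.
      by rewrite mul_delta_mx; apply/matrixP => a b; rewrite !ord1 !mxE.
    have := hq i; case: eqP => [di|_ /eqP <-].
      by case: (ltnP i p) => [/hc1|/hc2]; rewrite di ltxx.
    by rewrite tr_col rowE colE -!mulmxA -rowE !mulmxA -colE !mxE.
  by rewrite -PQ -mulmxA (mulmx1C QQ) mulmx1.
apply/seteqP; split=> [U /IAM_P [hU U_opt]|U ->]; last exact: dom_IAM.
have gU0 : Grass p U0 by case: hU0.
apply: projector_inj; rewrite (proj_max U0 gU0 (topE U0 hU0)).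
(* [U] attains [top] because it does at least as well as [U0], which attains it. *)
apply: proj_max => //; apply/le_anti.
by rewrite (bound U hU) -(topE U0 hU0) (U_opt U0 gU0).
Qed.
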